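(* Let $n\geq 1$ be an integer. The $n$-dimensional sphere $S^n$ has a moving finite unit tight frame (moving FUNTF) for its tangent bundle if and only if $n$ is odd. That is, there exist $k\geq n$ and vector fields $f_1,\dots,f_k$ on $S^n$ forming a moving finite unit tight frame for the tangent bundle of $S^n$ if and only if $n$ is odd.
   Context: The sphere is $S^n=\{a\in\mathbb{R}^{n+1}:\|a\|=1\}$, with the Riemannian metric given by the restriction of the standard inner product $\langle\cdot,\cdot\rangle$ of $\mathbb{R}^{n+1}$. For $a\in S^n$ the tangent space is identified with $T_aS^n=\{b\in\mathbb{R}^{n+1}:\langle a,b\rangle=0\}$. A vector field on $S^n$ is a continuous map $f:S^n\to TS^n$ with $f(a)\in T_aS^n$ for all $a\in S^n$ (equivalently, a continuous map $f:S^n\to\mathbb{R}^{n+1}$ with $\langle f(a),a\rangle=0$ for all $a$). A finite family of vector fields $(f_i)_{i=1}^k$ on $S^n$, with $k\geq n$, is a moving tight frame for the tangent bundle of $S^n$ if for every $a\in S^n$ there is a constant $C>0$ such that $$x=\frac1C\sum_{i=1}^k\langle x,f_i(a)\rangle f_i(a)\quad\text{for all }x\in T_aS^n.$$ It is a moving finite unit tight frame (moving FUNTF) if in addition $\|f_i(a)\|=1$ for all $1\leq i\leq k$ and all $a\in S^n$. *)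

(* Defs.v *)
From HB Require Import structures.
From mathcomp Require Import all_boot all_order all_algebra.
From mathcomp Require Import all_classical all_reals all_analysis.
Set Implicit Arguments.
Unset Strict Implicit.
Unset Printing Implicit Defensive.
Import Order.TTheory GRing.Theory Num.Theory.
Import numFieldNormedType.Exports.
Local Open Scope classical_set_scope.
Local Open Scope ring_scope.

Definition inner (R : realType) (m : nat) (x y : 'rV[R]_m) : R :=
  \sum_(i < m) x 0 i * y 0 i.

(* The norm `|x| that the library puts on 'rV[R]_m is the sup norm; it induces
   the usual topology, but lengths must be measured with the Euclidean norm. *)
Definition enorm (R : realType) (m : nat) (x : 'rV[R]_m) : R :=
  Num.sqrt (inner x x).

Definition sphere (R : realType) (n : nat) : set 'rV[R]_n.+1 :=
  [set a | enorm a = 1].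
Arguments sphere : clear implicits.

Definition tangent (R : realType) (n : nat) (a : 'rV[R]_n.+1) :
    set 'rV[R]_n.+1 :=
  [set b | inner a b = 0].

(* A vector field is represented by a map on the whole ambient space, of which
   only the restriction to the sphere matters: continuity is for the subspace
   topology, and the values off the sphere are never constrained. *)
Definition vector_field (R : realType) (n : nat)
    (f : 'rV[R]_n.+1 -> 'rV[R]_n.+1) : Prop :=
  {within sphere R n, continuous f} /\
  forall a, sphere R n a -> tangent a (f a).

Definition moving_tight_frame (R : realType) (n k : nat)
    (f : 'I_k -> 'rV[R]_n.+1 -> 'rV[R]_n.+1) : Prop :=
  [/\ (n <= k)%N,
      forall i, vector_field (f i) &
      forall a, sphere R n a ->
        exists2 C : R, 0 < C &
          forall x, tangent a x ->
            x = C^-1 *: \sum_(i < k) inner x (f i a) *: f i a].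

Definition moving_FUNTF (R : realType) (n k : nat)
    (f : 'I_k -> 'rV[R]_n.+1 -> 'rV[R]_n.+1) : Prop :=
  moving_tight_frame f /\
  forall i a, sphere R n a -> enorm (f i a) = 1.

(* Main.v *)
Require Import Defs.
From HB Require Import structures.
From mathcomp Require Import all_boot all_order all_algebra all_fingroup.
From mathcomp Require Import all_classical all_reals all_analysis.
From mathcomp Require Import -(notations) ssrcomplements mpoly.
From mathcomp Require polyrcf.
From mathcomp Require Import ring lra.
Set Implicit Arguments.
Unset Strict Implicit.
Unset Printing Implicit Defensive.
Import Order.TTheory GRing.Theory Num.Theory.
Import numFieldNormedType.Exports.
Local Open Scope classical_set_scope.
Local Open Scope ring_scope.

(* For odd n, the orthogonal complex structures of R^(n+1) attached to the
   signed perfect matchings of the coordinates each give a unit tangent field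
   J a.  Permuting the coordinates and reversing the edges of a matching kill
   all the terms of the frame operator except those making it a multiple of
   x |-> x - <x,a> a.

   For even n, any member of the frame would be a unit tangent field v, which
   is excluded as follows.  On the boundary of the cube [-1,1]^(n+1), approximate
   v(x/|x|) by a polynomial map W and put H(t,x) = - t x + (1 - t^2) W(x), which
   joins the identity to the antipodal map away from the origin.  For a
   polynomial p, the coefficients of the form H^*(p dy) are p(H) times the
   maximal minors of the Jacobian matrix of H; this form is closed, so the sum
   of its integrals over the faces of [-1,1]^(n+2) vanishes.  Take
   p = (1 - |y|^2/K)^N: since n+1 is odd, the two faces t = 1 and t = -1 add up,
   with a contribution of at least c r^N, whereas |H| >= 1/2 on the other
   faces, whose contribution is at most C q^N with q < r.  Letting N grow gives a
   contradiction.  Integration over a box is the linear form on polynomials that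
   sends a monomial to the product of the moments of its exponents. *)

(** * Moment functionals on polynomials *)

Definition riesz (R : nzRingType) (a : nat -> R) (q : {poly R}) : R :=
  \sum_(k < size q) q`_k * a k.

Lemma riesz_widen (R : nzRingType) (a : nat -> R) (q : {poly R}) n :
  (size q <= n)%N -> riesz a q = \sum_(k < n) q`_k * a k.
Proof.
move=> le_qn; rewrite /riesz.
rewrite (big_ord_widen n (fun k => q`_k * a k)) //.
rewrite big_mkcond /=; apply: eq_bigr => k _.
by case: ltnP => // /leq_sizeP ->; rewrite // mul0r.
Qed.

Lemma riesz_is_scalar (R : comNzRingType) (a : nat -> R) : scalar (riesz a).
Proof.
move=> c p q.
pose n := maxn (size (c *: p + q)) (maxn (size p) (size q)).
rewrite !(@riesz_widen _ _ _ n) ?leq_max ?leqnn ?orbT //.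
rewrite big_distrr -big_split /=; apply: eq_bigr => k _.
by rewrite coefD coefZ mulrDl mulrA.
Qed.

HB.instance Definition _ (R : comNzRingType) (a : nat -> R) :=
  GRing.isLinear.Build R {poly R} R *%R (riesz a) (riesz_is_scalar a).

Lemma rieszXn (R : comNzRingType) (a : nat -> R) n : riesz a 'X^n = a n.
Proof.
rewrite (@riesz_widen _ _ _ n.+1) ?size_polyXn // big_ord_recr /= coefXn eqxx.
rewrite mul1r big1 ?add0r // => k _.
by rewrite coefXn ltn_eqF ?mul0r.
Qed.

Lemma riesz_exp (R : comNzRingType) (x : R) q : riesz (fun k => x ^+ k) q = q.[x].
Proof. by rewrite horner_coef. Qed.

Lemma rieszB (R : comNzRingType) (a b : nat -> R) q :
  riesz (fun k => a k - b k) q = riesz a q - riesz b q.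
Proof. by rewrite /riesz -sumrB; apply: eq_bigr => k _; rewrite mulrBr. Qed.

(** Stands in for integration against a positive measure carried by [S]. *)
Definition moment_pos (R : realType) (S : set R) (a : nat -> R) :=
  forall q : {poly R}, (forall x, S x -> 0 <= q.[x]) -> 0 <= riesz a q.

Lemma moment_pos_exp (R : realType) (S : set R) x :
  S x -> moment_pos S (fun k => x ^+ k).
Proof. by move=> Sx q q0; rewrite riesz_exp q0. Qed.

(** The integral of [t ^+ k] over the segment from [a] to [b]. *)
Definition seg_moment (R : fieldType) (a b : R) (k : nat) : R :=
  (b ^+ k.+1 - a ^+ k.+1) / k.+1%:R.

(** The functional is the increment of a primitive of [q], whose sign the mean value theorem
    gives. *)
Lemma moment_pos_seg (R : realType) (S : set R) (a b : R) : a <= b ->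
  (forall x, a <= x <= b -> S x) -> moment_pos S (seg_moment a b).
Proof.
move=> le_ab subS q q0.
(* A primitive of [q]; its constant coefficient is a division by zero, hence [0]. *)
pose Q := \poly_(k < (size q).+1) (q`_k.-1 / k%:R).
have dQ : Q^`() = q.
  apply/polyP => k; rewrite coef_deriv coef_poly ltnS.
  case: ltnP => [_|/leq_sizeP ->//]; last by rewrite mul0rn.
  by rewrite /= -(mulr_natr (_ / _)) mulfVK // pnatr_eq0.
have hQ x : Q.[x] = \sum_(k < size q) q`_k / k.+1%:R * x ^+ k.+1.
  rewrite horner_poly big_ord_recl /= invr0 mulr0 mul0r add0r.
  by apply: eq_bigr.
suff -> : riesz (seg_moment a b) q = Q.[b] - Q.[a].
  move: le_ab; rewrite le_eqVlt => /predU1P[->|lt_ab]; first by rewrite subrr.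
  have [c /itvP c_ab ->] := polyrcf.poly_mvt Q lt_ab.
  rewrite dQ mulr_ge0 ?subr_ge0 ?(ltW lt_ab) //.
  by apply/q0/subS; rewrite !c_ab.
rewrite !hQ -sumrB /riesz; apply: eq_bigr => k _.
by rewrite /seg_moment; ring.
Qed.

(** The difference is the integral over the two outer segments, from [a] to [- r] and from [r] to
    [b]. *)
Lemma seg_momentB_pos (R : realType) (a b r : R) : 0 <= r -> a <= - r -> r <= b ->
  moment_pos (fun x => a <= x <= b)
    (fun k => seg_moment a b k - seg_moment (- r) r k).
Proof.
move=> r0 ar rb q q0.
have -> : riesz (fun k => seg_moment a b k - seg_moment (- r) r k) q =
          riesz (seg_moment a (- r)) q + riesz (seg_moment r b) q.
  rewrite /riesz -big_split; apply: eq_bigr => k _ /=.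
  by rewrite -mulrDr /seg_moment -mulrBl -mulrDl; congr (_ * (_ / _)); ring.
by rewrite addr_ge0 //; apply: moment_pos_seg q0 => // x /andP[? ?]; apply/andP; lra.
Qed.

(** Integration against the product of the measures with moments [a i]. *)
Definition tensor (R : nzRingType) d (a : 'I_d -> nat -> R) (p : mpoly d R) : R :=
  \sum_(m <- msupp p) mcoeff m p * \prod_i a i (m i).

Lemma tensor_widen (R : nzRingType) d (a : 'I_d -> nat -> R) (p : mpoly d R) k :
  (msize p <= k)%N ->
  tensor a p = \sum_(m : bmultinom d k) mcoeff m p * \prod_i a i ((m : multinom d) i).
Proof.
move=> le_pk; pose I : subFinType _ := bmultinom d k.
rewrite /tensor (big_mksub I) //=; first last.
- by move=> m /msize_mdeg_lt /leq_trans; apply.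
- exact: msupp_uniq.
rewrite big_rmcond //= => m /memN_msupp_eq0 ->.
by rewrite mul0r.
Qed.

Lemma tensor_is_scalar (R : comNzRingType) d (a : 'I_d -> nat -> R) :
  scalar (tensor a).
Proof.
move=> c p q.
pose n := maxn (msize (c *: p + q)) (maxn (msize p) (msize q)).
rewrite !(@tensor_widen _ _ _ _ n) ?leq_max ?leqnn ?orbT //.
rewrite big_distrr -big_split /=; apply: eq_bigr => k _.
by rewrite mcoeffD mcoeffZ mulrDl mulrA.
Qed.

HB.instance Definition _ (R : comNzRingType) d (a : 'I_d -> nat -> R) :=
  GRing.isLinear.Build R (mpoly d R) R *%R (tensor a) (tensor_is_scalar a).

Lemma tensorX (R : comNzRingType) d (a : 'I_d -> nat -> R) m :
  tensor a (mpolyX R m) = \prod_i a i (m i).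
Proof. by rewrite /tensor msuppX big_seq1 mcoeffX eqxx mul1r. Qed.

Lemma tensor1 (R : comNzRingType) d (a : 'I_d -> nat -> R) :
  tensor a 1 = \prod_i a i 0%N.
Proof.
rewrite -mpolyX0 tensorX; apply: eq_bigr => i _.
by rewrite mnm0E.
Qed.

Lemma tensor_exp (R : comNzRingType) d (x : 'I_d -> R) p :
  tensor (fun i k => x i ^+ k) p = meval x p.
Proof. by rewrite mevalE. Qed.

Definition upd (T : Type) d (a : 'I_d -> T) (j : 'I_d) (b : T) :=
  fun i => if i == j then b else a i.

(** Integrates out every variable but the [j]-th, as in Fubini's theorem. *)
Definition slice (R : nzRingType) d (a : 'I_d -> nat -> R) (j : 'I_d)
    (p : mpoly d R) : {poly R} :=
  \sum_(m <- msupp p) (mcoeff m p * \prod_(i | i != j) a i (m i)) *: 'X^(m j).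

Lemma tensor_slice (R : comNzRingType) d (a : 'I_d -> nat -> R) j b p :
  tensor (upd a j b) p = riesz b (slice a j p).
Proof.
rewrite /slice linear_sum; apply: eq_bigr => m _ /=.
rewrite (bigD1 j) //= linearZ /= rieszXn [upd a j b j]/upd eqxx.
rewrite (eq_bigr (fun i => a i (m i))); first by rewrite mulrA mulrAC.
by move=> i /negPf ij; rewrite /upd ij.
Qed.

Lemma eq_tensor (R : comNzRingType) d (a b : 'I_d -> nat -> R) p :
  (forall i, a i =1 b i) -> tensor a p = tensor b p.
Proof.
move=> ab; apply: eq_bigr => m _; congr (_ * _).
by apply: eq_bigr => i _; rewrite ab.
Qed.

(** Fundamental theorem of calculus in the variable [j]: for the moments of a segment, [b k] is the
    difference of the [k]-th powers of its ends. *)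
Lemma tensor_mderiv (R : comNzRingType) d (a : 'I_d -> nat -> R) j b p :
  (forall k, b k = k%:R * a j k.-1) ->
  tensor a (mderiv j p) = tensor (upd a j b) p.
Proof.
move=> bE; rewrite [p]mpolyE [mderiv _ _]linear_sum !linear_sum.
apply: eq_bigr => m _; rewrite linearZ !linearZ /=; congr (_ * _).
rewrite mderivX linearZ /= !tensorX (bigD1 j) //= [RHS](bigD1 j) //=.
rewrite [upd a j b j]/upd eqxx bE -mulrA mnmBE mnm1E eqxx subn1; congr (_ * (_ * _)).
apply: eq_bigr => i /negPf ij.
by rewrite /upd ij mnmBE mnm1E eq_sym ij subn0.
Qed.

Lemma upd_prefix (T : Type) d (a b : 'I_d -> T) (j i : 'I_d) :
  (if (i < j.+1)%N then a i else b i) =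
  upd (fun i : 'I_d => if (i < j)%N then a i else b i) j (a j) i.
Proof.
rewrite /upd; case: eqVneq => [->|ij]; first by rewrite leqnn.
by rewrite ltnS leq_eqVlt val_eqE (negPf ij).
Qed.

(** Evaluations are traded for the functionals [a i] one variable at a time; at each stage the slice
    in that variable is nonnegative on [S j]. *)
Lemma tensor_ge0 (R : realType) d (S : 'I_d -> set R) (a : 'I_d -> nat -> R) p :
  (forall i, moment_pos (S i) (a i)) ->
  (forall x, (forall i, S i (x i)) -> 0 <= meval x p) ->
  (exists x, forall i, S i (x i)) ->
  0 <= tensor a p.
Proof.
move=> a_pos p_pos [x0 Sx0].
(* The first [k] variables are integrated, the others are evaluated at [x]. *)
pose mixed k (x : 'I_d -> R) (i : 'I_d) :=
  if (i < k)%N then a i else fun e => x i ^+ e.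
suff mixed_ge0 k : forall x, (forall i, S i (x i)) -> 0 <= tensor (mixed k x) p.
  suff -> : tensor a p = tensor (mixed d x0) p by apply: mixed_ge0.
  by apply: eq_tensor => i e; rewrite /mixed ltn_ord.
elim: k => [|k IHk] x Sx.
  rewrite (@eq_tensor _ _ _ (fun i e => x i ^+ e)) ?tensor_exp; last by [].
  exact: p_pos.
have [le_dk|lt_kd] := leqP d k.
  suff -> : tensor (mixed k.+1 x) p = tensor (mixed k x) p by apply: IHk.
  apply: eq_tensor => i e.
  by rewrite /mixed !(leq_trans (ltn_ord i)) // ltnW.
pose j := Ordinal lt_kd.
rewrite (@eq_tensor _ _ _ (upd (mixed k x) j (a j))); last first.
  by move=> i e; rewrite /mixed (upd_prefix a (fun i e => x i ^+ e) j).
rewrite tensor_slice; apply: a_pos => t St.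
rewrite -riesz_exp -tensor_slice.
rewrite (@eq_tensor _ _ _ (mixed k (upd x j t))).
  by apply: IHk => i; rewrite /upd; case: eqVneq => [->|].
move=> i e; rewrite /upd /mixed; case: eqVneq => [->|//].
by rewrite ltnn.
Qed.

(** Changing [a] into [b] in one variable adds the functional of [b j - a j] at a slice, which
    [tensor_ge0] shows nonnegative on [S j]. *)
Lemma tensor_le (R : realType) d (S : 'I_d -> set R) (a b : 'I_d -> nat -> R) p :
  (forall i, moment_pos (S i) (a i)) -> (forall i, moment_pos (S i) (b i)) ->
  (forall i, moment_pos (S i) (fun k => b i k - a i k)) ->
  (forall x, (forall i, S i (x i)) -> 0 <= meval x p) ->
  (exists x, forall i, S i (x i)) ->
  tensor a p <= tensor b p.
Proof.
move=> a_pos b_pos ba_pos p_pos S_ex.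
pose mixed k (i : 'I_d) := if (i < k)%N then b i else a i.
suff mixed_le k : tensor a p <= tensor (mixed k) p.
  suff -> : tensor b p = tensor (mixed d) p by apply: mixed_le.
  by apply: eq_tensor => i e; rewrite /mixed ltn_ord.
elim: k => [|k IHk]; first by rewrite (@eq_tensor _ _ _ a).
apply: le_trans IHk _.
have [le_dk|lt_kd] := leqP d k.
  suff -> : tensor (mixed k.+1) p = tensor (mixed k) p by [].
  apply: eq_tensor => i e.
  by rewrite /mixed !(leq_trans (ltn_ord i)) // ltnW.
pose j := Ordinal lt_kd.
rewrite (@eq_tensor _ _ (mixed k.+1) (upd (mixed k) j (b j))); last first.
  by move=> i e; rewrite /mixed (upd_prefix b a j).
rewrite (@eq_tensor _ _ (mixed k) (upd (mixed k) j (a j))); last first.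
  by move=> i e; rewrite /upd /mixed; case: eqVneq => [->|//]; rewrite ltnn.
rewrite !tensor_slice -subr_ge0 -rieszB; apply: ba_pos => t St.
rewrite -riesz_exp -tensor_slice.
apply: (tensor_ge0 _ p_pos) => // i.
rewrite /upd; case: eqVneq => [->|_]; first exact: moment_pos_exp.
by rewrite /mixed; case: ifP.
Qed.

Lemma tensor_norm_le (R : realType) d (S : 'I_d -> set R) (a : 'I_d -> nat -> R)
    p (C : R) :
  (forall i, moment_pos (S i) (a i)) ->
  (forall x, (forall i, S i (x i)) -> `|meval x p| <= C) ->
  (exists x, forall i, S i (x i)) ->
  `|tensor a p| <= C * \prod_i a i 0%N.
Proof.
move=> a_pos p_le S_ex; rewrite -tensor1 ler_norml -subr_ge0 -[X in _ && X]subr_ge0.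
rewrite opprK; have -> : C * tensor a 1 = tensor a (C *: 1) by rewrite linearZ.
rewrite -raddfD -raddfB; apply/andP; split; apply: (tensor_ge0 a_pos) => //;
  move=> x /p_le; rewrite ?mevalD ?mevalB mevalZ meval1 ler_norml => /andP[]; lra.
Qed.

Lemma meval_le_norm (R : realType) d (p : mpoly d R) :
  exists2 C : R, 0 < C & forall x, (forall i, `|x i| <= 1) -> `|meval x p| <= C.
Proof.
exists (1 + \sum_(m <- msupp p) `|mcoeff m p|).
  by rewrite ltr_wpDr ?sumr_ge0.
move=> x x1; rewrite mevalE ler_wpDl // (le_trans (ler_norm_sum _ _ _)) //.
apply: ler_sum => m _; rewrite normrM ler_piMr // normr_prod.
by apply: prodr_ile1 => i; rewrite normr_ge0 normrX exprn_ile1.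
Qed.

(** * Closedness of the pullback of a top-degree form *)

Lemma mderiv_prod (R : comNzRingType) d (j : 'I_d) (I : finType) (P : pred I)
    (F : I -> mpoly d R) :
  mderiv j (\prod_(k | P k) F k) =
  \sum_(k | P k) mderiv j (F k) * \prod_(l | P l && (l != k)) F l.
Proof.
pose D := fun s : seq I => uniq s ->
  mderiv j (\prod_(k <- s | P k) F k) =
  \sum_(k <- s | P k) mderiv j (F k) * \prod_(l <- s | P l && (l != k)) F l.
suff DE s : D s by rewrite DE ?index_enum_uniq.
elim: s => [_|k s IHs] /=; first by rewrite !big_nil -mpolyC1 mderivC.
case/andP=> ks /IHs {}IHs; rewrite !big_cons.
have skip : \prod_(l <- s | P l && (l != k)) F l = \prod_(l <- s | P l) F l.
  rewrite big_seq_cond [RHS]big_seq_cond; apply: eq_bigl => l.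
  by case: eqVneq => [->|]; rewrite ?(negPf ks) ?andbT.
case: ifP => Pk; last first.
  by rewrite IHs; apply: eq_bigr => i _; rewrite big_cons Pk.
rewrite mderivM IHs eqxx /= skip mulr_sumr; congr (_ + _).
rewrite big_seq_cond [RHS]big_seq_cond; apply: eq_bigr => i /andP[si Pi].
rewrite big_cons Pk /=; case: eqVneq => [ki|_]; last by rewrite mulrCA.
by rewrite ki si in ks.
Qed.

(** The free top row turns the maximal minors of the Jacobian of [H] into cofactors of a square
    matrix. *)
Definition jac (R : nzRingType) m (r : 'I_m.+1 -> mpoly m.+1 R)
    (H : 'I_m -> mpoly m.+1 R) : 'M[mpoly m.+1 R]_m.+1 :=
  \matrix_(i, j) if unlift ord0 i is Some k then mderiv j (H k) else r j.

Definition jacobian_minor (R : comNzRingType) m (H : 'I_m -> mpoly m.+1 R) j :=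
  cofactor (jac (fun=> 0) H) ord0 j.

Lemma cofactor_jac (R : comNzRingType) m (r : 'I_m.+1 -> mpoly m.+1 R) H j :
  cofactor (jac r H) ord0 j = jacobian_minor H j.
Proof.
rewrite /jacobian_minor /cofactor; congr (_ * \det _).
by apply/matrixP => i k; rewrite !mxE liftK.
Qed.

(** Expansion along the top row of a determinant in which the gradient of [H k] occurs twice. *)
Lemma mderiv_jacobian_minor (R : comNzRingType) m (H : 'I_m -> mpoly m.+1 R) k :
  \sum_j mderiv j (H k) * jacobian_minor H j = 0.
Proof.
pose r j := mderiv j (H k).
have detE : \det (jac r H) = \sum_j r j * jacobian_minor H j.
  rewrite (expand_det_row _ ord0); apply: eq_bigr => j _.
  by rewrite cofactor_jac mxE unlift_none.
rewrite -detE; apply: (determinant_alternate (neq_lift ord0 k)) => j.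
by rewrite !mxE unlift_none liftK.
Qed.

(** The Piola identity: second derivatives are symmetric while signatures alternate. *)
Lemma jacobian_minor_divergence (R : numFieldType) m (H : 'I_m -> mpoly m.+1 R) :
  \sum_j mderiv j (jacobian_minor H j) = 0.
Proof.
pose A := jac (fun=> 0) H.
(* The term in which the derivative along [s ord0] falls on row [k] of the product attached to
   [s]. *)
pose T k (s : 'S_m.+1) := (-1) ^+ s *
  (mderiv (s ord0) (A k (s k)) *
     \prod_(l | (ord0 != l) && (l != k)) A l (s l)).
transitivity (\sum_(k | ord0 != k) \sum_s T k s).
  rewrite exchange_big /= (partition_big (fun s : 'S_m.+1 => s ord0) predT) //=.
  apply: eq_bigr => j _.
  rewrite /jacobian_minor expand_cofactor linear_sum /=.
  apply: eq_bigr => s /eqP s0.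
  have sgnE : (-1) ^+ s = mpolyC m.+1 ((-1) ^+ s : R) by rewrite rmorph_sign.
  rewrite sgnE mderiv_mulC mderiv_prod mulr_sumr; apply: eq_bigr => k _.
  by rewrite /T s0 sgnE.
rewrite big1 // => k k0; set S := \sum_s _.
(* Composing with the transposition of [ord0] and [k] swaps the two directions of differentiation
   and flips the sign. *)
have SN : S = - S.
  rewrite {1}/S (reindex_inj (mulgI (tperm ord0 k))) /= -sumrN.
  apply: eq_bigr => s _; rewrite /T odd_permM odd_tperm k0 addTb signrN mulNr.
  rewrite !permM tpermL tpermR.
  have -> : mderiv (s k) (A k (s ord0)) = mderiv (s ord0) (A k (s k)).
    rewrite /A !mxE.
    by case: unlift => [i|]; rewrite ?mderiv0 // mderiv_comm.
  rewrite (eq_bigr (fun l => A l (s l))) // => l /andP[l0 lk].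
  by rewrite permM tpermD // eq_sym.
have /eqP : 2%:R *: S = 0 by rewrite scaler_nat mulr2n {2}SN subrr.
by rewrite scaler_eq0 pnatr_eq0 => /eqP.
Qed.

(** The hypothesis is what the chain rule gives when [p] is a function of [H]; the gradient of each
    [H k] is orthogonal to the vector of minors. *)
Lemma divergence_pullback (R : numFieldType) m (H : 'I_m -> mpoly m.+1 R) p q :
  (forall j, mderiv j p = \sum_k q k * mderiv j (H k)) ->
  \sum_j mderiv j (p * jacobian_minor H j) = 0.
Proof.
move=> dp; under eq_bigr do rewrite mderivM dp.
rewrite big_split /= -mulr_sumr jacobian_minor_divergence mulr0 addr0.
under eq_bigr do rewrite mulr_suml.
rewrite exchange_big big1 //= => k _.
under eq_bigr do rewrite -mulrA.
by rewrite -mulr_sumr mderiv_jacobian_minor mulr0.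
Qed.

(** * Bernstein approximation in several variables *)

(** Over a general ring, so as to serve both for the polynomial and for its values. *)
Definition bern (A : pzRingType) N (s : A) k : A :=
  s ^+ k * (1 - s) ^+ (N - k) *+ 'C(N, k).

Lemma bern_ge0 (R : numDomainType) N (s : R) k :
  0 <= s <= 1 -> 0 <= bern N s k.
Proof.
by case/andP=> s0 s1; rewrite mulrn_wge0 // mulr_ge0 // exprn_ge0 // subr_ge0.
Qed.

Lemma sum_bern (R : comNzRingType) N (s : R) : \sum_(k < N.+1) bern N s k = 1.
Proof.
rewrite -[RHS](expr1n _ N) -[in RHS](subrK s 1) exprDn.
by apply: eq_bigr => k _; rewrite /bern mulrC.
Qed.

(** Conditioning on the last of [N.+1] independent trials of success probability [s]. *)
Lemma sum_bernS (R : comNzRingType) N (s : R) (phi : nat -> R) :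
  \sum_(k < N.+2) bern N.+1 s k * phi k =
  \sum_(k < N.+1) bern N s k * (s * phi k.+1 + (1 - s) * phi k).
Proof.
pose c k := s ^+ k * (1 - s) ^+ (N.+1 - k) * phi k.
pose g k := bern N s k * ((1 - s) * phi k).
have gE k : g k = c k *+ 'C(N, k).
  rewrite /g /c /bern; have [le_kN|lt_Nk] := leqP k N; last first.
    by rewrite bin_small // !mulr0n mul0r.
  by rewrite subSn // exprS -!(mulr_natr (_ * _)); ring.
under [RHS]eq_bigr do rewrite mulrDr.
rewrite big_split /=.
have -> : \sum_(k < N.+1) bern N s k * ((1 - s) * phi k) =
          \sum_(k < N.+2) c k *+ 'C(N, k).
  rewrite [RHS]big_ord_recr /= bin_small // mulr0n addr0.
  by apply: eq_bigr => k _; exact: gE.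
rewrite big_ord_recl [X in _ = _ + X]big_ord_recl addrCA.
congr (_ + _); first by rewrite /bern /c !bin0 !mulr1n.
rewrite -big_split; apply: eq_bigr => k _ /=.
rewrite /bern /c /bump leq0n add1n subSS binS exprS -!(mulr_natr (_ * _)) natrD; ring.
Qed.

(** Each further trial adds [s * (1 - s)] to the variance of the binomial law. *)
Lemma bern_variance (R : comNzRingType) N (s : R) :
  \sum_(k < N.+1) bern N s k * (k%:R - N%:R * s) ^+ 2 = N%:R * (s * (1 - s)).
Proof.
elim: N => [|N IHN].
  by rewrite big_ord1 /= !mul0r subrr expr0n /= mulr0.
rewrite (sum_bernS _ _ (fun k => (k%:R - N.+1%:R * s) ^+ 2)).
rewrite -[N.+1%:R in RHS]natr1 mulrDl mul1r -IHN.
have -> : s * (1 - s) = \sum_(k < N.+1) bern N s k * (s * (1 - s)).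
  by rewrite -mulr_suml sum_bern mul1r.
rewrite -big_split /=; apply: eq_bigr => k _.
by rewrite -!natr1; ring.
Qed.

Lemma sum_prod_bern (R : comNzRingType) N m (s : 'I_m -> R) :
  \sum_(k : {ffun 'I_m -> 'I_N.+1}) \prod_i bern N (s i) (k i) = 1.
Proof.
rewrite -(bigA_distr_bigA (fun i (k : 'I_N.+1) => bern N (s i) k)) big1 //.
by move=> i _; exact: sum_bern.
Qed.

Lemma sum_prod_bern1 (R : comNzRingType) N m (s : 'I_m -> R) j (phi : nat -> R) :
  \sum_(k : {ffun 'I_m -> 'I_N.+1}) (\prod_i bern N (s i) (k i)) * phi (k j) =
  \sum_(l < N.+1) bern N (s j) l * phi l.
Proof.
pose F i (k : 'I_N.+1) := bern N (s i) k * (if i == j then phi k else 1).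
transitivity (\sum_(k : {ffun 'I_m -> 'I_N.+1}) \prod_i F i (k i)).
  apply: eq_bigr => k _; rewrite big_split /=; congr (_ * _).
  by rewrite -big_mkcond big_pred1_eq.
rewrite -bigA_distr_bigA (bigD1 j) //= [X in _ * X]big1 => [|i /negPf ij].
  by rewrite mulr1; apply: eq_bigr => l _; rewrite /F eqxx.
by rewrite -[RHS](sum_bern N (s i)); apply: eq_bigr => l _; rewrite /F ij mulr1.
Qed.

(** Chebyshev's inequality: nodes far from the point carry little weight. Nodes can leave [K], so
    [h] is bounded everywhere and compared with points outside [K]. The map [ix] places the
    polynomial in a ring with other variables. *)
Lemma bernstein_approx (R : realType) m d (ix : 'I_m -> 'I_d) (K : set 'rV[R]_m)
    (h : 'rV[R]_m -> R) (M : R) :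
  (forall y, `|h y| <= M) ->
  (forall x, K x -> forall i, `|x 0 i| <= 1) ->
  (forall e : R, 0 < e -> exists2 r : R, 0 < r & forall x y : 'rV[R]_m, K x ->
     (forall i, `|y 0 i - x 0 i| < r) -> `|h y - h x| <= e) ->
  forall e : R, 0 < e -> exists p : mpoly d R,
    forall x, K (\row_i x (ix i)) -> `|meval x p - h (\row_i x (ix i))| <= e.
Proof.
move=> hM K1 h_unif e e0.
have M0 : 0 <= M by apply: le_trans (hM 0).
have e20 : 0 < e / 2 by rewrite divr_gt0.
have [r r0 hr] := h_unif _ e20.
pose C := 2 * M / r ^+ 2 * m%:R.
have C0 : 0 <= C by rewrite !mulr_ge0 // invr_ge0 exprn_ge0 // ltW.
pose N := (Num.truncn (2 * C / e)).+1.
have N0 : 0 < N%:R :> R by rewrite ltr0n.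
have CN : C / N%:R <= e / 2.
  rewrite ler_pdivrMr // mulrAC ler_pdivlMr // mulrC [e * _]mulrC -ler_pdivrMr //.
  exact/ltW/truncnS_gt.
(* A grid on the cube [[-1, 1]^m]; [half] is the change of variable back to [[0, 1]]. *)
pose node (k : {ffun 'I_m -> 'I_N.+1}) : 'rV[R]_m :=
  \row_i (2 * (k i)%:R / N%:R - 1).
pose half j := mpolyC d (2^-1) * (1 + mpolyX R (mnm1 (ix j))).
exists (\sum_k mpolyC d (h (node k)) * \prod_j bern N (half j) (k j)) => x Kx.
set y := \row_i x (ix i).
pose s j := 2^-1 * (1 + y 0 j).
have s01 j : 0 <= s j <= 1.
  by have /ler_normlP[] := K1 _ Kx j; rewrite -/y /s => ? ?; apply/andP; split; lra.
pose w (k : {ffun 'I_m -> 'I_N.+1}) := \prod_j bern N (s j) (k j).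
have w0 k : 0 <= w k by apply: prodr_ge0 => j _; apply: bern_ge0.
have -> : meval x (\sum_k mpolyC d (h (node k)) * \prod_j bern N (half j) (k j)) =
          \sum_k w k * h (node k).
  rewrite raddf_sum; apply: eq_bigr => k _ /=.
  rewrite mevalM mevalC mulrC rmorph_prod; congr (_ * _).
  apply: eq_bigr => j _ /=; rewrite rmorphMn rmorphM !rmorphXn rmorphB rmorph1 /=.
  by rewrite /half mevalM mevalC mevalD meval1 mevalXU /bern /s /y mxE.
have -> : h y = \sum_k w k * h y by rewrite -mulr_suml sum_prod_bern mul1r.
rewrite -sumrB.
apply: le_trans (ler_norm_sum _ _ _) _.
pose D k := \sum_j (node k 0 j - y 0 j) ^+ 2.
(* Near nodes are paid for by [e / 2]; at a far node [D k] is at least [r ^+ 2], so the second term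
   reaches the trivial bound [2 * M]. *)
apply: (@le_trans _ _ (\sum_k w k * (e / 2 + 2 * M / r ^+ 2 * D k))).
  apply: ler_sum => k _; rewrite -mulrBr normrM ger0_norm // ler_wpM2l //.
  have D0 : 0 <= 2 * M / r ^+ 2 * D k.
    rewrite !mulr_ge0 ?invr_ge0 ?exprn_ge0 ?(ltW r0) ?sumr_ge0 // => j _.
    exact: sqr_ge0.
  have [near|] := pselect (forall j, `|node k 0 j - y 0 j| < r).
    by rewrite ler_wpDr // hr.
  move=> /existsNP[j /negP]; rewrite -leNgt => far.
  have : `|h (node k) - h y| <= 2 * M.
    by rewrite (le_trans (ler_normB _ _)) // mulr_natl mulr2n lerD.
  move/le_trans; apply; rewrite ler_wpDl ?(ltW e20) //.
  rewrite -mulrA ler_peMr ?mulr_ge0 // mulrC ler_pdivlMr ?exprn_gt0 // mul1r.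
  rewrite /D (bigD1 j) //= ler_wpDr ?sumr_ge0 // => [i _|]; first exact: sqr_ge0.
  by rewrite -[leRHS]real_normK ?num_real // lerXn2r ?nnegrE // ltW.
under eq_bigr do rewrite mulrDr.
rewrite big_split /= -mulr_suml sum_prod_bern mul1r [leRHS]splitr lerD2l.
under eq_bigr do rewrite mulrCA.
rewrite -mulr_sumr.
apply: le_trans CN; rewrite /C -[leRHS]mulrA ler_wpM2l //.
  by rewrite !mulr_ge0 // invr_ge0 exprn_ge0 // ltW.
under eq_bigr do rewrite mulr_sumr.
rewrite exchange_big /=.
have -> : m%:R / N%:R = \sum_(j < m) N%:R^-1 :> R.
  by rewrite sumr_const card_ord mulr_natl.
apply: ler_sum => j _.
(* A node differs from the point by [2 / N] times the deviation of [k j] from its mean. *)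
rewrite (eq_bigr (fun k : {ffun 'I_m -> 'I_N.+1} =>
    (2 / N%:R) ^+ 2 * (w k * ((k j)%:R - N%:R * s j) ^+ 2))); last first.
  by move=> k _; rewrite !mxE /s !mxE; field; rewrite lt0r_neq0.
rewrite -mulr_sumr (sum_prod_bern1 _ s j (fun l => (l%:R - N%:R * s j) ^+ 2)).
rewrite bern_variance.
have -> : (2 / N%:R) ^+ 2 * (N%:R * (s j * (1 - s j))) =
          (4 * (s j * (1 - s j))) / N%:R :> R by field; rewrite lt0r_neq0.
rewrite ler_piMl ?invr_ge0 ?(ltW N0) //.
by have := sqr_ge0 (2 * s j - 1); nra.
Qed.

(** * The homotopy between the identity and the antipodal map *)

Lemma geometric_gap (R : realType) (q r C P : R) :
  0 <= q < r -> 0 < P -> exists N, C * q ^+ N < P * r ^+ N.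
Proof.
move=> /andP[q0 qr] P0; have r0 : 0 < r by apply: le_lt_trans qr.
have z0 : 0 <= q / r by rewrite divr_ge0 // ltW.
have z1 : `|q / r| < 1 by rewrite ger0_norm // ltr_pdivrMr ?mul1r.
have C0 : 0 < `|C| + 1 by rewrite ltr_wpDl.
have e0 : 0 < P / (`|C| + 1) by rewrite divr_gt0.
have /cvgrPdist_lt /(_ _ e0) [N _ /(_ N (leqnn N)) /=] := cvg_expr z1.
rewrite sub0r normrN normrX ger0_norm // => lt_z.
have qE : q ^+ N = (q / r) ^+ N * r ^+ N.
  by rewrite expr_div_n divfK // expf_neq0 // lt0r_neq0.
exists N; rewrite qE mulrA ltr_pM2r ?exprn_gt0 //.
move: lt_z; rewrite ltr_pdivlMr // => lt_z; apply: le_lt_trans lt_z.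
rewrite mulrC ler_wpM2l ?exprn_ge0 //.
by rewrite (le_trans (ler_norm C)) // lerDl.
Qed.

Lemma meval_mderivX (R : comNzRingType) d (x : 'I_d -> R) j k :
  meval x (mderiv k (mpolyX R (mnm1 j))) = (j == k)%:R.
Proof.
rewrite mderivX mnm1E mevalZ mevalX; case: eqVneq => [->|_]; last by rewrite mul0r.
by rewrite mul1r big1 // => i _; rewrite mnmBE subnn expr0.
Qed.

(** Integration over the face [x j = e] of a cube of half-side [c]. *)
Definition face_moment (R : realType) d (c : R) (j : 'I_d) (e : R) (i : 'I_d) :=
  upd (fun=> seg_moment (- c) c) j (fun k => e ^+ k) i.

Definition face (R : realType) d (c : R) (j : 'I_d) (e : R) (i : 'I_d) : set R :=
  [set t | if i == j then t = e else - c <= t <= c].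

Lemma face_moment_pos (R : realType) d (c b : R) (j : 'I_d) (e : R) i :
  0 <= c <= b -> moment_pos (face b j e i) (face_moment c j e i).
Proof.
move=> /andP[c0 cb]; rewrite /face_moment /upd; case: eqVneq => [->|ij].
  by apply: moment_pos_exp; rewrite /face /= eqxx.
apply: moment_pos_seg; first lra.
by move=> x /andP[? ?]; rewrite /face /= (negPf ij); apply/andP; split; lra.
Qed.

Lemma face_nonempty (R : realType) d (c : R) (j : 'I_d) (e : R) :
  0 <= c -> exists x, forall i, face c j e i (x i).
Proof.
move=> c0; exists (fun i => if i == j then e else 0) => i.
by rewrite /face /=; case: eqVneq => // _; rewrite oppr_le0 c0.
Qed.

Lemma face_moment0_gt0 (R : realType) d (c : R) (j : 'I_d) (e : R) :
  0 < c -> 0 < \prod_i face_moment c j e i 0%N.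
Proof.
move=> c0; apply: prodr_gt0 => i _; rewrite /face_moment /upd.
by case: ifP => _; rewrite /seg_moment ?expr0 // !expr1 invr1; lra.
Qed.

Lemma face_moment_le (R : realType) d (c b : R) (j : 'I_d) (e : R) p :
  0 <= c <= b -> (forall x, (forall i, face b j e i (x i)) -> 0 <= meval x p) ->
  tensor (face_moment c j e) p <= tensor (face_moment b j e) p.
Proof.
move=> /andP[c0 cb] p0; have b0 : 0 <= b by apply: le_trans cb.
apply: (tensor_le (S := face b j e)) => // [i|i|i|].
- by apply: face_moment_pos; rewrite c0.
- by apply: face_moment_pos; rewrite b0 lexx.
- rewrite /face_moment /upd; case: eqVneq => [->|ij] q q0.
    by rewrite rieszB subrr.
  apply: (@seg_momentB_pos _ _ _ c) => //; first by rewrite lerN2.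
  by move=> x xb; apply: q0; rewrite /face /= (negPf ij).
- exact: face_nonempty.
Qed.

(** The divergence theorem on [[-1, 1]^d], from the fundamental theorem of calculus in each
    variable. *)
Lemma tensor_stokes (R : realType) d (p : 'I_d -> mpoly d R) :
  \sum_j mderiv j (p j) = 0 ->
  \sum_j (tensor (face_moment 1 j 1) (p j) -
          tensor (face_moment 1 j (-1)) (p j)) = 0.
Proof.
move/(congr1 (tensor (fun=> seg_moment (-1) 1))).
rewrite linear0 linear_sum /= => {2}<-; apply: eq_bigr => j _.
rewrite (@tensor_mderiv _ _ _ _ (fun k => 1 ^+ k - (-1) ^+ k)).
  by rewrite /face_moment !tensor_slice rieszB.
case=> [|k]; first by rewrite mul0r !expr0 subrr.
by rewrite /seg_moment mulrC divfK // pnatr_eq0.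
Qed.

Lemma mderiv_exp (R : comNzRingType) d (j : 'I_d) (p : mpoly d R) N :
  mderiv j (p ^+ N) = (p ^+ N.-1 *+ N) * mderiv j p.
Proof.
elim: N => [|N IHN]; first by rewrite expr0 mulr0n mul0r -mpolyC1 mderivC.
rewrite exprS mderivM IHN; case: N {IHN} => [|N] /=.
  by rewrite !expr0 mulr0n mul0r mulr0 addr0 mulr1n mulrC.
by rewrite [in RHS]mulrS mulrDl [mderiv _ _ * _]mulrC mulrA mulrnAr -exprS.
Qed.

Definition homotopy (R : nzRingType) m (W : 'I_m -> mpoly m.+1 R) (i : 'I_m) :=
  let T := mpolyX R (mnm1 ord0) in
  - (T * mpolyX R (mnm1 (lift ord0 i))) + (1 - T * T) * W i.

Lemma meval_homotopy (R : comNzRingType) m (W : 'I_m -> mpoly m.+1 R) i x :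
  meval x (homotopy W i) =
  - (x ord0 * x (lift ord0 i)) + (1 - x ord0 * x ord0) * meval x (W i).
Proof. by rewrite mevalD mevalN !mevalM mevalB mevalM meval1 !mevalXU. Qed.

Lemma meval_homotopy_end (R : comNzRingType) m (W : 'I_m -> mpoly m.+1 R) i x :
  x ord0 * x ord0 = 1 -> meval x (homotopy W i) = - x ord0 * x (lift ord0 i).
Proof. by move=> x0; rewrite meval_homotopy x0 subrr mul0r addr0 mulNr. Qed.

(** The factor [1 - t^2] vanishes and does not depend on the space variables, which leaves [- t]
    times the identity matrix. *)
Lemma meval_jacobian_minor_end (R : comNzRingType) m
    (W : 'I_m -> mpoly m.+1 R) x :
  x ord0 * x ord0 = 1 ->
  meval x (jacobian_minor (homotopy W) ord0) = (- x ord0) ^+ m.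
Proof.
move=> x0; rewrite /jacobian_minor /cofactor addn0 expr0 mul1r -det_map_mx.
rewrite -det_scalar; congr (\det _); apply/matrixP => i k; rewrite !mxE liftK /=.
rewrite mderivD mderivN !mderivM mderivB mderivM -mpolyC1 mderivC.
rewrite !(mevalD, mevalN, mevalM, mevalB, mevalC, meval0, meval_mderivX, mevalXU).
rewrite x0 (inj_eq lift_inj) (negPf (neq_lift _ _)) eq_sym.
by rewrite -(mulr_natr (- _)) !mulr0n; ring.
Qed.

Lemma no_polynomial_homotopy (R : realType) m (W : 'I_m -> mpoly m.+1 R) :
  odd m ->
  ~ (forall x : 'I_m.+1 -> R, (forall i, `|x i| <= 1) ->
       (exists i : 'I_m, `|x (lift ord0 i)| = 1) ->
       1 / 4 <= \sum_i meval x (homotopy W i) ^+ 2).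
Proof.
move=> m_odd W_lb; pose H i : mpoly m.+1 R := homotopy W i; pose D := jacobian_minor H.
pose Q : mpoly m.+1 R := \sum_i H i * H i.
have QE x : meval x Q = \sum_i meval x (H i) ^+ 2.
  rewrite /Q raddf_sum /=; by apply: eq_bigr => i _; rewrite mevalM expr2.
have Q0 x : 0 <= meval x Q by rewrite QE sumr_ge0 // => i _; apply: sqr_ge0.
have [K0 K0_gt0 K0P] := meval_le_norm Q.
(* Bounds both [Q] on the cube and [m], so that [1 - Q / K] lies in [[0, 1]] on every face. *)
pose K := K0 + m.+1%:R.
have m1 : 1 <= m.+1%:R :> R by rewrite ler1n.
have K1 : 1 <= K by rewrite /K; lra.
have K_gt0 : 0 < K by apply: lt_le_trans K1.
have V_le1 : 0 < K^-1 <= 1 by rewrite invr_gt0 K_gt0 invf_le1.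
pose G N := (1 - mpolyC m.+1 K^-1 * Q) ^+ N.
have GE x N : meval x (G N) = (1 - K^-1 * meval x Q) ^+ N.
  by rewrite /G rmorphXn /= mevalB meval1 mevalM mevalC.
have divG N : \sum_j mderiv j (G N * D j) = 0.
  (* [G N] depends on [H] alone; these are its partial derivatives with respect to the components of
     [H]. *)
  apply: (@divergence_pullback _ _ _ _ (fun k =>
    ((1 - mpolyC m.+1 K^-1 * Q) ^+ N.-1 *+ N) *
      (- (mpolyC m.+1 K^-1 * (H k + H k))))) => j.
  rewrite /G mderiv_exp /=; set c := (_ *+ N).
  rewrite mderivB -mpolyC1 mderivC sub0r mderiv_mulC.
  rewrite /Q linear_sum mulr_sumr -sumrN mulr_sumr; apply: eq_bigr => k _ /=.
  by rewrite mderivM; ring.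
have [C CP] : exists C : 'I_m.+1 -> R, forall j x,
    (forall i, `|x i| <= 1) -> `|meval x (D j)| <= C j.
  suff /choice[C CP] : forall j, exists c : R, forall x,
    (forall i, `|x i| <= 1) -> `|meval x (D j)| <= c by exists C.
  by move=> j; have [c _ cP] := meval_le_norm (D j); exists c.
(* On the sides [Q >= 1/4], so [1 - Q / K <= q]; on the part of the ends where the space coordinates
   are at most [rho] in absolute value, [Q <= 1/8], so [1 - Q / K >= r]. *)
pose q := 1 - K^-1 / 4; pose r := 1 - K^-1 / 8; pose rho : R := (8 * m.+1%:R)^-1.
have qr : 0 <= q < r by rewrite /q /r; case/andP: V_le1 => *; apply/andP; split; lra.
have rho0 : 0 < rho by rewrite invr_gt0 mulr_gt0 // ltr0n.
have rho_m : m.+1%:R * rho = 1 / 8 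
  by rewrite /rho invfM mulrCA divff ?pnatr_eq0 // mulr1 mul1r.
have rho1 : rho <= 1 by nra.
have face_norm (b : R) j (e : R) (x : 'I_m.+1 -> R) : 0 <= b <= 1 -> `|e| = 1 ->
    (forall i, face b j e i (x i)) -> forall i, `|x i| <= 1.
  move=> /andP[b0 b1] e1 fx i; have := fx i; rewrite /face /=.
  case: eqVneq => _; first by move=> ->; rewrite e1.
  by move=> /andP[? ?]; rewrite ler_norml; apply/andP; split; lra.
pose P (e : R) : R := \prod_(i < m.+1) face_moment rho ord0 e i 0%N.
(* On an end the minor is [(- e) ^+ m = - e] as [m] is odd, so the integrand becomes [G N], which is
   then bounded below on the small face of half-side [rho]. *)
have end_le N (e : R) : e * e = 1 ->
    P e * r ^+ N <= - e * tensor (face_moment 1 ord0 e) (G N * D ord0).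
  move=> ee; have e1 : `|e| = 1.
    by apply/eqP; rewrite -sqrp_eq1 // -normrX expr2 ee normr1.
  pose p := mpolyC m.+1 (- e) * (G N * D ord0).
  have pE b (x : 'I_m.+1 -> R) : 0 <= b <= 1 -> (forall i, face b ord0 e i (x i)) ->
      [/\ 0 <= meval x Q, meval x Q <= m%:R * b ^+ 2 &
          meval x p = (1 - K^-1 * meval x Q) ^+ N].
    move=> b01 fx; have xe : x ord0 = e by have := fx ord0; rewrite /face /= ?eqxx.
    split=> //.
      have -> : m%:R * b ^+ 2 = \sum_(i < m) b ^+ 2.
        by rewrite sumr_const card_ord mulr_natl.
      rewrite QE; apply: ler_sum => i _; rewrite meval_homotopy_end xe //.
      rewrite exprMn sqrrN expr2 ee mul1r.
      have := fx (lift ord0 i); rewrite /face /=.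
      by move=> /andP[? ?]; nra.
    have DE : meval x (D ord0) = (- e) ^+ m.
      by rewrite -xe; apply: meval_jacobian_minor_end; rewrite xe.
    rewrite /p mevalM mevalM mevalC GE DE.
    rewrite exprNn -signr_odd m_odd expr1; have -> : e ^+ m = e.
      rewrite -[m]odd_double_half m_odd add1n exprS -muln2 mulnC exprM expr2 ee.
      by rewrite expr1n mulr1.
    by ring: ee.
  have tp : - e * tensor (face_moment 1 ord0 e) (G N * D ord0) =
            tensor (face_moment 1 ord0 e) p.
    by rewrite /p mul_mpolyC linearZ.
  rewrite tp; apply: (@le_trans _ _ (tensor (face_moment rho ord0 e) p)); last first.
    apply: face_moment_le; first by rewrite rho1 ltW.
    move=> x fx; have [|q0 qm ->] := pE 1 x _ fx; first by rewrite ler01 lexx.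
    apply: exprn_ge0; rewrite subr_ge0 ler_pdivrMl // mulr1.
    by rewrite (le_trans qm) // expr1n mulr1 /K -natr1; lra.
  have -> : P e * r ^+ N = tensor (face_moment rho ord0 e) (r ^+ N *: (1 : mpoly m.+1 R)).
    by rewrite linearZ /= tensor1 mulrC.
  rewrite -subr_ge0 -raddfB; apply: (tensor_ge0 (S := face rho ord0 e)).
  - by move=> i; apply: face_moment_pos; rewrite lexx ltW.
  - move=> x fx; rewrite mevalB mevalZ meval1 mulr1.
    have [|q0 qm ->] := pE rho x _ fx; first by rewrite rho1 ltW.
    have qle : meval x Q <= 1 / 8.
      by rewrite (le_trans qm) // -rho_m expr2 -natr1; nra.
    rewrite subr_ge0 lerXn2r ?nnegrE //; first by case/andP: qr; lra.
      by case/andP: V_le1; rewrite /r; nra.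
    by case/andP: V_le1; rewrite /r; nra.
  - by apply: face_nonempty; rewrite ltW.
pose B j (e : R) := \prod_(i < m.+1) face_moment 1 j e i 0%N : R.
have side_le N i (e : R) : `|e| = 1 ->
    `|tensor (face_moment 1 (lift ord0 i) e) (G N * D (lift ord0 i))| <=
    C (lift ord0 i) * B (lift ord0 i) e * q ^+ N.
  move=> e1; set j := lift ord0 i; rewrite mulrAC.
  apply: (tensor_norm_le (S := face 1 j e)).
  - by move=> k; apply: face_moment_pos; rewrite ler01 lexx.
  - move=> x fx; have x1 := face_norm _ _ _ _ _ e1 fx.
    have {}x1 : forall k, `|x k| <= 1 by apply: x1; rewrite ler01 lexx.
    have Q_lb : 1 / 4 <= meval x Q.
      rewrite QE; apply: W_lb => //; exists i.
      by have := fx j; rewrite /face /= eqxx => ->.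
    have Q_ub : meval x Q <= K.
      by rewrite (le_trans (ler_norm _)) // (le_trans (K0P _ x1)) // lerDl.
    rewrite mevalM GE normrM mulrC ler_pM ?CP // normrX lerXn2r ?nnegrE //.
      by case/andP: qr.
    have KQ : K^-1 * meval x Q <= 1 by rewrite ler_pdivrMl ?mulr1.
    rewrite ger0_norm ?subr_ge0 //.
    by case/andP: V_le1; rewrite /q; nra.
  - exact: face_nonempty.
pose Ctot := \sum_i (C (lift ord0 i) * B (lift ord0 i) 1 +
                     C (lift ord0 i) * B (lift ord0 i) (-1)).
have P0 : 0 < P 1 + P (-1) by rewrite addr_gt0 // face_moment0_gt0.
have [N] := geometric_gap Ctot qr P0.
apply/negP; rewrite -leNgt.
(* The index [ord0] gives the two ends, whose contributions have the same sign; the other indices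
   give the sides. *)
have := tensor_stokes (divG N); rewrite big_ord_recl /=.
set F1 := tensor _ _; set F2 := tensor _ _; set S := \sum_i _ => stokes.
have F1_le : P 1 * r ^+ N <= - 1 * F1 by apply: end_le; rewrite mulr1.
have F2_le : P (-1) * r ^+ N <= - -1 * F2 by apply: end_le; rewrite mulrNN mulr1.
have S_le : S <= Ctot * q ^+ N.
  rewrite mulr_suml; apply: ler_sum => i _; rewrite mulrDl; apply: lerD.
    exact: le_trans (ler_norm _) (side_le N i 1 (normr1 _)).
  apply: le_trans (ler_norm _) _; rewrite normrN.
  exact: side_le N i (-1) (normrN1 _).
rewrite mulrDl; clearbody F1 F2 S; clear - stokes F1_le F2_le S_le.
by lra.
Qed.

(** * Radial extension of a vector field *)

Lemma inner_ge0 (R : realType) m (x : 'rV[R]_m) : 0 <= inner x x.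
Proof. by apply: sumr_ge0 => i _; rewrite -expr2 sqr_ge0. Qed.

Lemma inner0l (R : realType) m (y : 'rV[R]_m) : inner 0 y = 0.
Proof. by rewrite /inner big1 // => i _; rewrite mxE mul0r. Qed.

Lemma inner_gt0 (R : realType) m (x : 'rV[R]_m) : x != 0 -> 0 < inner x x.
Proof.
move=> x0; rewrite lt_neqAle inner_ge0 andbT eq_sym; apply: contra_neq x0 => xx0.
apply/rowP => i; rewrite mxE; apply/eqP; rewrite -sqrf_eq0 expr2.
move/eqP: xx0; rewrite psumr_eq0 => [/allP/(_ i)|j _]; last by rewrite -expr2 sqr_ge0.
by rewrite mem_index_enum => /(_ isT).
Qed.

Lemma innerZl (R : realType) m (c : R) (x y : 'rV[R]_m) :
  inner (c *: x) y = c * inner x y.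
Proof. by rewrite mulr_sumr; apply: eq_bigr => i _; rewrite mxE mulrA. Qed.

Lemma innerC (R : realType) m (x y : 'rV[R]_m) : inner x y = inner y x.
Proof. by apply: eq_bigr => i _; rewrite mulrC. Qed.

Lemma enorm_eq1 (R : realType) m (x : 'rV[R]_m) : enorm x = 1 -> inner x x = 1.
Proof. by move=> x1; rewrite -(sqr_sqrtr (inner_ge0 x)) -/(enorm x) x1 expr1n. Qed.

Lemma inner_sqr_continuous (R : realType) m :
  continuous (fun x : 'rV[R]_m => inner x x).
Proof.
move=> x; apply: cvg_big => [||i _]; [exact: add_continuous | exact: nbhs_filter |].
by apply: cvgM; [exact: nbhs_filter | exact: coord_continuous | exact: coord_continuous].
Qed.

Definition radial (R : realType) m (x : 'rV[R]_m) := (enorm x)^-1 *: x.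

Lemma enorm_gt0 (R : realType) m (x : 'rV[R]_m) : x != 0 -> 0 < enorm x.
Proof. by move=> x0; rewrite sqrtr_gt0 inner_gt0. Qed.

Lemma enorm_radial (R : realType) m (x : 'rV[R]_m) : x != 0 -> enorm (radial x) = 1.
Proof.
move=> x0; rewrite /enorm innerZl innerC innerZl -[inner x x]sqr_sqrtr ?inner_ge0 //.
rewrite -/(enorm x) mulrA -expr2 exprVn mulVf ?sqrtr1 // expf_neq0 //.
by rewrite gt_eqF ?enorm_gt0.
Qed.

Lemma radial_continuous (R : realType) m (x : 'rV[R]_m) :
  x != 0 -> {for x, continuous (@radial R m)}.
Proof.
move=> x0; have ec : enorm y @[y --> x] --> enorm x.
  apply: (@continuous_comp _ _ _ (fun y : 'rV[R]_m => inner y y) Num.sqrt).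
    exact: inner_sqr_continuous.
  exact: sqrt_continuous.
have e0 : enorm x != 0 by rewrite gt_eqF ?enorm_gt0.
exact: (cvgZ (cvgV e0 ec) cvg_id).
Qed.

(** Radial projection lands in the sphere, so continuity relative to the sphere becomes ordinary
    continuity off the origin. *)
Lemma within_radial_continuous (R : realType) n
    (f : 'rV[R]_n.+1 -> 'rV[R]_n.+1) (x : 'rV[R]_n.+1) :
  {within sphere R n, continuous f} -> x != 0 ->
  {for x, continuous (f \o @radial R n.+1)}.
Proof.
move=> /subspace_continuousP fc x0; have Sx := enorm_radial x0.
have rc := radial_continuous x0.
apply: (@cvg_comp _ _ _ (@radial R n.+1) f _ _ _ _ (fc _ Sx)) => A /= nA.
have near0 : \forall y \near x, 0 < inner y y.
  apply: (@inner_sqr_continuous R n.+1 x [set t | 0 < t]).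
  by apply: lt_nbhsr; apply: inner_gt0.
have nA' : \forall y \near x, sphere R n (radial y) -> A (radial y).
  exact: (rc _ nA).
suff : \forall y \near x, A (radial y) by [].
near=> y; apply: (near nA' y) => //; apply: enorm_radial.
have : 0 < inner y y by near: y.
by apply: contraTneq => ->; rewrite inner0l ltxx.
Unshelve. all: by end_near.
Qed.

(** This part of the cube contains its boundary and avoids the origin, where radial projection is
    singular. *)
Lemma compact_cube_shell (R : realType) m :
  compact [set x : 'rV[R]_m | (forall i, `|x 0 i| <= 1) /\ 1 <= inner x x].
Proof.
rewrite (_ : [set x | _] = [set x : 'rV[R]_m | forall i, `[-1, 1]%classic (x 0 i)]
    `&` (fun x : 'rV[R]_m => inner x x) @^-1` [set y | 1 <= y]).
  apply: compact_closedI.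
    by apply: (@rV_compact R m (fun=> `[-1, 1]%classic)) => i; apply: segment_compact.
  apply: preimage_closed; last exact: closed_ge.
  by move=> x _; exact: inner_sqr_continuous.
apply/seteqP; split=> x /= [x1 xx]; split=> // i; have := x1 i;
  by rewrite /= in_itv /= ler_norml.
Qed.

(** Heine's theorem with only [x] confined to [K], the form that [bernstein_approx] requires. *)
Lemma compact_uniform (R : realType) m (K : set 'rV[R]_m) (h : 'rV[R]_m -> R) :
  compact K -> (forall x, K x -> {for x, continuous h}) ->
  forall e : R, 0 < e -> exists2 r : R, 0 < r & forall x y : 'rV[R]_m, K x ->
     (forall i, `|y 0 i - x 0 i| < r) -> `|h y - h x| <= e.
Proof.
move=> /compact_near_coveringP Kc hc e e0.
have e20 : 0 < e / 2 by rewrite divr_gt0.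
pose P (r : R) (x : 'rV[R]_m) := forall y : 'rV[R]_m,
  (forall i, `|y 0 i - x 0 i| < r) -> `|h y - h x| <= e.
have Pnear : \forall r \near 0^'+, K `<=` P r.
  apply: Kc => x Kx; move/cvgrPdist_lt: (hc x Kx) => /(_ _ e20) /nbhs_ballP[d d0 hd].
  have d20 : 0 < d / 2 by rewrite divr_gt0.
  exists (ball x (d / 2), [set r | r < d / 2]).
    by split=> /=; [exact: nbhsx_ballx | exact: nbhs_right_lt].
  move=> [x' r] /= [x'x rd] y yx'.
  have hx' : `|h x - h x'| < e / 2 by apply: hd; apply: le_ball x'x; lra.
  have hy : `|h x - h y| < e / 2.
    apply: hd; rewrite (splitr d); apply: ball_triangle x'x _.
    split=> // i j; rewrite ord1.
    rewrite /ball /= distrC; apply: lt_trans rd; exact: yx'.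
  rewrite -(subrKA (h x)); apply: le_trans (ler_normD _ _) _.
  by rewrite distrC; lra.
have [r [r0 KP]] : exists r : R, 0 < r /\ K `<=` P r.
  near (0 : R)^'+ => r; exists r; split; first by near: r; exact: nbhs_right_gt.
  by near: r.
by exists r => // x y Kx; apply: KP.
Unshelve. all: by end_near.
Qed.

(** * The hairy ball theorem *)

Lemma shell_approx (R : realType) n (f : 'rV[R]_n.+1 -> 'rV[R]_n.+1) (e : R) :
  vector_field f -> (forall a, sphere R n a -> enorm (f a) = 1) -> 0 < e ->
  exists W : 'I_n.+1 -> mpoly n.+2 R, forall (x : 'I_n.+2 -> R) i,
    let y : 'rV[R]_n.+1 := \row_j x (lift ord0 j) in
    (forall j, `|y 0 j| <= 1) -> 1 <= inner y y ->
    `|meval x (W i) - f (radial y) 0 i| <= e.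
Proof.
move=> [fc _] f1 e0.
(* [radial 0] is [0], where [f] is uncontrolled; the value [0] there makes [h i] bounded on the
   whole space. *)
pose h i (y : 'rV[R]_n.+1) := if y == 0 then 0 else f (radial y) 0 i.
pose K := [set x : 'rV[R]_n.+1 | (forall i, `|x 0 i| <= 1) /\ 1 <= inner x x].
have K_neq0 (y : 'rV[R]_n.+1) : 1 <= inner y y -> y != 0.
  by apply: contraTneq => ->; rewrite inner0l ler10.
have h1 i y : `|h i y| <= 1.
  rewrite /h; case: eqVneq => [_|y0]; first by rewrite normr0.
  have ff := enorm_eq1 (f1 _ (enorm_radial y0)).
  rewrite -(expr_le1 (ltn0Sn 1)) // real_normK ?num_real //.
  rewrite -[leRHS]ff /inner (bigD1 i) //=.
  by rewrite -expr2 lerDl sumr_ge0 // => j _; rewrite -expr2 sqr_ge0.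
have hc i x : K x -> {for x, continuous (h i)}.
  move=> [_ /K_neq0 x0].
  have near0 : \forall y \near x, 0 < inner y y.
    apply: (@inner_sqr_continuous R n.+1 x [set t | 0 < t]).
    by apply: lt_nbhsr; apply: inner_gt0.
  have gc : {for x, continuous (fun y => f (radial y) 0 i)}.
    apply: (@continuous_comp _ _ _ (f \o @radial R n.+1) (fun y => y 0 i)).
      exact: within_radial_continuous.
    exact: coord_continuous.
  have hE : h i x = f (radial x) 0 i by rewrite /h (negPf x0).
  move=> A /=; rewrite hE => nA.
  have nA' : \forall y \near x, A (f (radial y) 0 i) by exact: gc _ nA.
  suff : \forall y \near x, A (h i y) by [].
  near=> y.
  have y0 : y != 0.
    have : 0 < inner y y by near: y.
    by apply: contraTneq => ->; rewrite inner0l ltxx.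
  by rewrite /h (negPf y0); apply: (near nA' y).
suff /choice[W WP] : forall i, exists p : mpoly n.+2 R, forall x : 'I_n.+2 -> R,
    K (\row_j x (lift ord0 j)) ->
    `|meval x p - h i (\row_j x (lift ord0 j))| <= e.
  exists W => x i y y1 yy; have := WP i x (conj y1 yy).
  by rewrite /h (negPf (K_neq0 _ yy)).
move=> i; apply: (@bernstein_approx R n.+1 n.+2 (lift ord0) K (h i) 1) => //.
  by move=> x [].
exact: (compact_uniform (@compact_cube_shell R n.+1) (hc i)).
Unshelve. all: by end_near.
Qed.

(** As [v] is a unit vector orthogonal to [y], the exact homotopy [a] has squared length at least
    [3/4] on the boundary of the cube; the polynomial one keeps [1/4], against
    [no_polynomial_homotopy] in odd dimension [n.+1]. *)
Lemma hairy_ball (R : realType) n (f : 'rV[R]_n.+1 -> 'rV[R]_n.+1) :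
  vector_field f -> (forall a, sphere R n a -> enorm (f a) = 1) -> odd n.
Proof.
move=> vf f1; apply/negPn/negP => n_even.
pose e : R := (8 * n.+1%:R)^-1.
have e0 : 0 < e by rewrite invr_gt0 mulr_gt0 // ltr0n.
have n1 : 1 <= n.+1%:R :> R by rewrite ler1n.
have e_n : n.+1%:R * e = 1 / 8.
  by rewrite /e invfM mulrCA divff ?pnatr_eq0 // mulr1 mul1r.
have [W WP] := shell_approx vf f1 e0.
apply: (@no_polynomial_homotopy R n.+1 W) => // x x1 [k xk].
set t := x ord0; pose y : 'rV[R]_n.+1 := \row_j x (lift ord0 j).
have y1 j : `|y 0 j| <= 1 by rewrite mxE.
have yy : 1 <= inner y y.
  rewrite /inner (bigD1 k) //= -expr2 -real_normK ?num_real // mxE xk expr1n.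
  by rewrite lerDl sumr_ge0 // => j _; rewrite -expr2 sqr_ge0.
have y0 : y != 0.
  by apply: contraTneq yy => ->; rewrite inner0l ler10.
pose v := f (radial y); have Sy := enorm_radial y0.
have vv : inner v v = 1 by apply/enorm_eq1/f1.
have yv : inner y v = 0.
  have := vf.2 _ Sy; rewrite /tangent /= /radial innerZl => /eqP.
  by rewrite mulf_eq0 invr_eq0 gt_eqF ?enorm_gt0 //= => /eqP.
pose a i := - t * y 0 i + (1 - t * t) * v 0 i.
have t01 : 0 <= t * t <= 1.
  have : `|t| <= 1 by exact: x1.
  by rewrite ler_norml => /andP[? ?]; apply/andP; split; nra.
have aa : \sum_i a i ^+ 2 = t * t * inner y y + (1 - t * t) ^+ 2.
  transitivity (t * t * inner y y + (1 - t * t) ^+ 2 * inner v v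
                - 2 * t * (1 - t * t) * inner y v); last first.
    by rewrite vv yv mulr0 subr0 mulr1.
  rewrite /inner !mulr_sumr -big_split -sumrB; apply: eq_bigr => i _ /=.
  by rewrite /a; ring.
(* From [(a + d)^2 >= a^2 / 2 - d^2], which is the nonnegativity of [(a + 2d)^2]. *)
have lb i : a i ^+ 2 / 2 - e ^+ 2 <= meval x (homotopy W i) ^+ 2.
  rewrite meval_homotopy -/t; have := WP x i y1 yy; rewrite -/y -/v.
  set w := meval x (W i); rewrite ler_norml => /andP[? ?].
  have : (w - v 0 i) ^+ 2 <= e ^+ 2 by nra.
  set d := w - v 0 i => d_le.
  have -> : - (t * x (lift ord0 i)) + (1 - t * t) * w = a i + (1 - t * t) * d.
    by rewrite /a /d mxE; ring.
  have : ((1 - t * t) * d) ^+ 2 <= d ^+ 2.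
    rewrite exprMn ler_piMl ?sqr_ge0 //.
    by case/andP: t01 => *; rewrite expr_le1 //; lra.
  have := sqr_ge0 (a i + 2 * ((1 - t * t) * d)); nra.
apply: le_trans (ler_sum _ (fun i _ => lb i)).
rewrite sumrB -mulr_suml aa sumr_const card_ord.
rewrite -[e ^+ 2 *+ _]mulr_natl [e ^+ 2]expr2 mulrA e_n.
have e_le : e <= 1 / 8 by nra.
case/andP: t01 => *.
have syy : t * t <= t * t * inner y y by rewrite ler_peMr.
(* With [s = t^2], [s + (1 - s)^2 = 3/4 + (s - 1/2)^2]. *)
have := sqr_ge0 (t * t - 1 / 2).
move: (t * t) (inner y y) syy => s Y; nra.
Qed.

(** * Tight frames from signed perfect matchings *)

Local Notation signed_perm m := ({perm 'I_m} * {ffun 'I_m -> bool})%type.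

(* A signed perfect matching: [p.1] exchanges the two ends of each edge and
   [p.2] orients the edge, so that the signed permutation matrix it defines is
   an orthogonal complex structure. *)
Definition signed_matchings m : {set signed_perm m} :=
  [set p : signed_perm m |
    [forall i, p.1 (p.1 i) == i] && [forall i, p.2 (p.1 i) == ~~ p.2 i]].

Definition matching_field (R : realType) m (p : signed_perm m)
    (a : 'rV[R]_m) : 'rV[R]_m := \row_i ((-1) ^+ p.2 i * a 0 (p.1 i)).

Lemma signed_matchingsP m (p : signed_perm m) :
  reflect ((forall i, p.1 (p.1 i) = i) /\ (forall i, p.2 (p.1 i) = ~~ p.2 i))
    (p \in signed_matchings m).
Proof.
rewrite inE; apply: (iffP andP) => -[tK eN]; split; try by apply/forallP => i; apply/eqP.
  by move=> i; apply/eqP/(forallP tK).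
by move=> i; apply/eqP/(forallP eN).
Qed.

Lemma signed_matchings_neq m (p : signed_perm m) i :
  p \in signed_matchings m -> p.1 i != i.
Proof. by move=> /signed_matchingsP[_ /(_ i)]; case: eqP => // ->; case: (p.2 i). Qed.

(** The two ends of an edge contribute opposite terms. *)
Lemma inner_matching_field (R : realType) m p (a : 'rV[R]_m) :
  p \in signed_matchings m -> inner a (matching_field p a) = 0.
Proof.
move=> /signed_matchingsP[tK eN].
have : inner a (matching_field p a) = - inner a (matching_field p a).
  rewrite {1}/inner (reindex_inj (@perm_inj _ p.1)) -sumrN.
  by apply: eq_bigr => i _; rewrite !mxE tK eN signrN; ring.
by move=> ?; lra.
Qed.

Lemma enorm_matching_field (R : realType) m p (a : 'rV[R]_m) :
  enorm (matching_field p a) = enorm a.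
Proof.
rewrite /enorm; congr Num.sqrt; rewrite [RHS](reindex_inj (@perm_inj _ p.1)).
apply: eq_bigr => i _; rewrite !mxE.
by rewrite mulrACA -expr2 sqrr_sign mul1r.
Qed.

Lemma matching_field_continuous (R : realType) m p :
  continuous (@matching_field R m p).
Proof.
rewrite (_ : @matching_field R m p = fun a : 'rV[R]_m =>
    \sum_j ((-1) ^+ p.2 j * a 0 (p.1 j)) *: delta_mx 0 j); last first.
  apply/funext => b; rewrite [LHS]row_sum_delta.
  by apply: eq_bigr => j _; rewrite mxE.
have cc (a : 'rV[R]_m) i : (fun b : 'rV[R]_m =>
    ((-1) ^+ p.2 i * b 0 (p.1 i)) *: delta_mx 0 i : 'rV[R]_m) @ a -->
    ((-1) ^+ p.2 i * a 0 (p.1 i)) *: (delta_mx 0 i : 'rV[R]_m).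
  have cb : (fun b : 'rV[R]_m => b 0 (p.1 i)) @ a --> a 0 (p.1 i).
    exact: coord_continuous.
  exact: (cvgZr_tmp (cvgMl_tmp cb)).
move=> a; apply: cvg_big => [||i _]; [exact: add_continuous | exact: nbhs_filter |].
exact: cc.
Qed.

Definition edge_count m (i l : 'I_m) :=
  #|[set p in signed_matchings m | p.1 i == l]|.

Lemma edge_count_diag m (i : 'I_m) : edge_count i i = 0%N.
Proof.
apply/eqP; rewrite cards_eq0; apply/eqP/setP => p; rewrite !inE.
apply/negP => /andP[pM]; apply/negP/signed_matchings_neq.
by rewrite inE.
Qed.

(** Relabelling the coordinates by [s] permutes the signed matchings. *)
Lemma edge_count_perm m (s : {perm 'I_m}) i l :
  edge_count (s i) (s l) = edge_count i l.
Proof.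
pose act (s : {perm 'I_m}) (p : signed_perm m) :=
  ((p.1 ^ s)%g, [ffun i => p.2 (s^-1%g i)]).
have act_perm r p j : (act r p).1 (r j) = r (p.1 j) by rewrite permJ.
have act_sign r p j : (act r p).2 (r j) = p.2 j by rewrite ffunE permK.
have act_in r p : p \in signed_matchings m -> act r p \in signed_matchings m.
  move=> /signed_matchingsP[tK eN]; apply/signed_matchingsP.
  by split=> j; rewrite -[j](permKV r) !(act_perm, act_sign) ?tK ?eN.
have act_inj r : injective (act r).
  move=> [t e] [t' e'] [/conjg_inj -> /ffunP ee]; congr (_, _).
  by apply/ffunP => j; have := ee (r j); rewrite !ffunE permK.
have le (r : {perm 'I_m}) j k : (edge_count j k <= edge_count (r j) (r k))%N.
  rewrite /edge_count -[leqLHS](card_imset _ (act_inj r)).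
  apply: subset_leq_card; apply/fintype.subsetP => q /imsetP[p].
  rewrite inE => /andP[pM /eqP pj] {q}->.
  by rewrite inE act_in //= act_perm pj eqxx.
apply/eqP; rewrite eqn_leq le andbT.
by have := le s^-1%g (s i) (s l); rewrite !permK.
Qed.

(** The symmetric group is doubly transitive: exchange [i] with [j], then the image of [l] with [k],
    which leaves [j] fixed. *)
Lemma edge_count_const m (i l j k : 'I_m) :
  i != l -> j != k -> edge_count i l = edge_count j k.
Proof.
move=> il jk; pose l1 := tperm i j l.
have l1j : l1 != j by rewrite (inv_eq (tpermK i j)) tpermR eq_sym.
rewrite -(edge_count_perm (tperm i j)) tpermL -/l1.
rewrite -(edge_count_perm (tperm l1 k)) tpermL tpermD //.
by rewrite eq_sym.
Qed.

Lemma signed_matchings_exists m :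
  ~~ odd m -> exists p, p \in signed_matchings m.
Proof.
move=> m_even.
(* Pairs [2j] with [2j + 1]; parity then orients the edges. *)
pose g i := if odd i then i.-1 else i.+1.
have gK : involutive g.
  by case=> // i; rewrite /g /=; case oi: (odd i); rewrite /= ?negbK oi.
have g_lt (i : 'I_m) : (g i < m)%N.
  rewrite /g; case: ifP => [_|i_even]; first by rewrite (leq_ltn_trans (leq_pred i)).
  rewrite ltn_neqAle ltn_ord andbT; apply: contraNneq m_even => <-.
  by rewrite /= i_even.
pose t i := Ordinal (g_lt i).
have tK : involutive t by move=> i; apply: val_inj; rewrite /= gK.
exists (perm (inv_inj tK), [ffun i : 'I_m => odd i]).
apply/signed_matchingsP; split=> i; rewrite ?ffunE /= !permE ?tK //.
rewrite /t /g /=; case: (nat_of_ord i) => // j /=.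
by case oj: (odd j); rewrite /= ?negbK oj.
Qed.

Lemma signed_matchings_flip m (i : 'I_m) (p : signed_perm m) :
  p \in signed_matchings m ->
  (p.1, [ffun k => p.2 k (+) ((k == i) || (k == p.1 i))]) \in signed_matchings m.
Proof.
move=> /signed_matchingsP[tK eN]; apply/signed_matchingsP; split=> k //=.
rewrite !ffunE eN addNb (can2_eq tK tK) (inj_eq perm_inj).
by rewrite orbC.
Qed.

(** Every coordinate other than [i] is the partner of [i] equally often; [i0] and [j0] name this
    common count. *)
Lemma sum_matching_diag (R : realType) m (i0 j0 i : 'I_m) (a : 'rV[R]_m) :
  i0 != j0 ->
  \sum_(p in signed_matchings m) a 0 (p.1 i) ^+ 2 =
  (edge_count i0 j0)%:R * (inner a a - a 0 i ^+ 2).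
Proof.
move=> ij0; rewrite (partition_big (fun p : signed_perm m => p.1 i) predT) //=.
transitivity (\sum_l (edge_count i l)%:R * a 0 l ^+ 2).
  apply: eq_bigr => l _; rewrite (eq_bigr (fun=> a 0 l ^+ 2)) => [|p /andP[_ /eqP->] //].
  rewrite sumr_const mulr_natl; congr (_ *+ _).
  by apply: eq_card => p; rewrite [RHS]inE unfold_in.
rewrite (bigD1 i) //= edge_count_diag mul0r add0r [inner a a](bigD1 i) //=.
rewrite -expr2 addrAC subrr add0r mulr_sumr; apply: eq_bigr => l li.
by rewrite expr2 (edge_count_const (j := i0) (k := j0)) // eq_sym.
Qed.

(** If [p] joins [i] to [j], the opposite signs at the two ends give [- (a 0 i * a 0 j)]. Otherwise
    reversing the edge at [i] changes the sign of the [i]-th entry but not of the [j]-th, and these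
    terms cancel. *)
Lemma sum_matching_offdiag (R : realType) m (i j : 'I_m) (a : 'rV[R]_m) :
  i != j ->
  \sum_(p in signed_matchings m) matching_field p a 0 i * matching_field p a 0 j =
  - ((edge_count i j)%:R * (a 0 i * a 0 j)).
Proof.
move=> ij; rewrite (bigID (fun p : signed_perm m => p.1 i == j)) /=.
rewrite [X in X + _](eq_bigr (fun=> - (a 0 i * a 0 j))); last first.
  move=> p /andP[/signed_matchingsP[tK eN] /eqP pi].
  rewrite !mxE -pi tK eN signrN.
  have := sqrr_sign R (p.2 i); set e := (-1) ^+ _ => ee.
  by rewrite mulNr mulrN mulrACA -expr2 ee mul1r mulrC.
rewrite [X in _ + X](_ : _ = 0) ?addr0.
  rewrite sumr_const mulr_natl -mulNrn; congr (_ *+ _).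
  by apply: eq_card => p; rewrite [RHS]inE unfold_in.
pose flip (p : signed_perm m) : signed_perm m :=
  (p.1, [ffun k => p.2 k (+) ((k == i) || (k == p.1 i))]).
have flipK : involutive flip.
  move=> [t e]; congr (_, _); apply/ffunP => k.
  by rewrite !ffunE -addbA addbb addbF.
set S := \sum_(p | _) _.
suff : S = - S by move=> ?; lra.
rewrite {1}/S (reindex_inj (inv_inj flipK)) /= -sumrN; apply: eq_big => p.
  congr (_ && _); apply/idP/idP => [|/signed_matchings_flip->] //.
  by move/(signed_matchings_flip i); rewrite -/(flip _) -/(flip _) flipK.
move=> /andP[_ pij]; rewrite !mxE /= !ffunE eqxx [j == i]eq_sym (negPf ij).
by rewrite [j == p.1 i]eq_sym (negPf pij) addbT addbF signrN !mulNr.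
Qed.

(** The frame operator is a multiple of the orthogonal projection onto the tangent space at [a]. *)
Lemma sum_matching_fields (R : realType) m (i0 j0 : 'I_m) (a x : 'rV[R]_m) :
  i0 != j0 -> inner a a = 1 -> inner a x = 0 ->
  \sum_(p in signed_matchings m) inner x (matching_field p a) *: matching_field p a =
  (edge_count i0 j0)%:R *: x.
Proof.
move=> ij0 aa ax; apply/rowP => i; rewrite summxE mxE.
transitivity (\sum_j x 0 j * \sum_(p in signed_matchings m)
    matching_field p a 0 i * matching_field p a 0 j).
  under [RHS]eq_bigr do rewrite mulr_sumr.
  rewrite exchange_big; apply: eq_bigr => p _ /=.
  by rewrite mxE mulr_suml; apply: eq_bigr => j _; rewrite mulrCA mulrC mulrA.
transitivity ((edge_count i0 j0)%:R *
    \sum_j ((j == i)%:R * x 0 j - a 0 i * (a 0 j * x 0 j))).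
  rewrite mulr_sumr; apply: eq_bigr => j _; case: eqVneq => [->|ji].
    rewrite (eq_bigr (fun p : signed_perm m => a 0 (p.1 i) ^+ 2)); last first.
      by move=> p _; rewrite mxE mulrACA -expr2 sqrr_sign mul1r expr2.
    by rewrite (sum_matching_diag _ _ ij0) aa mulr1n; ring.
  rewrite sum_matching_offdiag 1?eq_sym // (edge_count_const _ ij0) 1?eq_sym //.
  by rewrite mulr0n; ring.
rewrite sumrB -mulr_sumr -/(inner a x) ax mulr0 subr0 (bigD1 i) //= eqxx mul1r.
by rewrite big1 ?addr0 // => j /negPf->; rewrite mul0r.
Qed.

(** Gives the lower bound on the size of the frame: [ord0] has [n.+1] possible partners, all equally
    frequent. *)
Lemma card_signed_matchings n :
  #|signed_matchings n.+2| = (edge_count ord0 (ord_max : 'I_n.+2) * n.+1)%N.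
Proof.
rewrite -sum1_card (partition_big (fun p : signed_perm n.+2 => p.1 ord0) predT) //=.
transitivity (\sum_(l : 'I_n.+2) edge_count ord0 l)%N.
  by apply: eq_bigr => l _; rewrite sum1_card; apply: eq_card => p;
    rewrite [RHS]inE unfold_in.
rewrite big_ord_recl edge_count_diag add0n.
rewrite (eq_bigr (fun=> edge_count ord0 (ord_max : 'I_n.+2))); last first.
  by move=> l _; apply: edge_count_const.
by rewrite sum_nat_const card_ord mulnC.
Qed.

Lemma edge_count_gt0 m (i l : 'I_m) : ~~ odd m -> i != l -> (0 < edge_count i l)%N.
Proof.
move=> /signed_matchings_exists[p pM] il.
rewrite (@edge_count_const _ i l i (p.1 i)) //; last first.
  by rewrite eq_sym signed_matchings_neq.
by apply/card_gt0P; exists p; rewrite inE pM eqxx.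
Qed.

Lemma moving_FUNTF_odd (R : realType) n : odd n ->
  exists (k : nat) (f : 'I_k -> 'rV[R]_n.+1 -> 'rV[R]_n.+1), moving_FUNTF f.
Proof.
case: n => // n n_odd; have m_even : ~~ odd n.+2 by rewrite oddS n_odd.
have ij : ord0 != ord_max :> 'I_n.+2 by [].
have N0 := edge_count_gt0 m_even ij.
exists #|signed_matchings n.+2|, (fun c => matching_field (enum_val c)).
split; last by move=> c a Sa; rewrite enorm_matching_field.
split; first by rewrite card_signed_matchings leq_pmull.
  move=> c; split.
    by apply: continuous_subspaceT; apply: matching_field_continuous.
  by move=> a _; apply: inner_matching_field; apply: enum_valP.
move=> a Sa; exists (edge_count ord0 (ord_max : 'I_n.+2))%:R; first by rewrite ltr0n.
move=> x ax.
rewrite -(big_enum_val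
  (fun p => inner x (matching_field p a) *: matching_field p a)).
rewrite (sum_matching_fields ij (enorm_eq1 Sa) ax) scalerA mulVf ?scale1r //.
by rewrite pnatr_eq0 -lt0n.
Qed.

Theorem mainTheorem1 (R : realType) (n : nat) (hn : (1 <= n)%N) :
  (exists (k : nat) (f : 'I_k -> 'rV[R]_n.+1 -> 'rV[R]_n.+1), moving_FUNTF f)
  <-> odd n.
Proof.
split; last exact: moving_FUNTF_odd.
move=> [k [f [[le_nk f_field _] f_unit]]].
(* Since [1 <= n <= k], the family has a member. *)
pose i := Ordinal (leq_trans hn le_nk).
exact: hairy_ball (f_field i) (f_unit i).
Qed.
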